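(* Let $H$ be a real Hilbert space with $\dim(H)\geq 2$, $\delta\in(0,2)$, and $\mu,\theta\in[0,1]$ satisfying $\mu\geq\theta$ and $\mu\theta>1-\delta$. Then $$\Phi_H(\mu,\theta,\delta)=\begin{cases} 1-\theta & \text{if } 1-\delta\geq\theta^2+\theta\,\dfrac{\mu^2-\theta^2}{2},\\[2mm] \max\left\{1-\theta,\ \sqrt{\delta-2\lambda_\delta\sqrt{\mu^2\theta^2-(1-\delta)^2}}\right\} & \text{if } 1-\delta<\theta^2+\theta\,\dfrac{\mu^2-\theta^2}{2}, \end{cases}$$ where $$\lambda_\delta=\frac{-2\sqrt{\mu^2\theta^2-(1-\delta)^2}+\sqrt{4\big(\mu^2+\theta^2-2+2\delta\big)-(\mu^2-\theta^2)^2}}{2\big(\mu^2+\theta^2-2+2\delta\big)}.$$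
   Context: For a real Hilbert space $H$, the dual $H^*$ is identified with $H$, a vector $y\in H$ acting on $x\in H$ by the inner product $\langle x,y\rangle$. With this identification, $\Pi(H)=\{(z,z) : z\in H,\ \|z\|=1\}\subset H\times H$, and for $(x,y)\in H\times H$, $$d_\infty\big((x,y),\Pi(H)\big):=\inf\big\{\max\{\|x-z\|,\|y-z\|\} : z\in H,\ \|z\|=1\big\}.$$ For $\delta\in(0,2)$ and $\mu,\theta\in[0,1]$ with $\mu\theta\geq 1-\delta$ define $$\Phi_H(\mu,\theta,\delta):=\sup\left\{d_\infty\big((x,y),\Pi(H)\big) : x,y\in H,\ \|x\|=\mu,\ \|y\|=\theta,\ \langle x,y\rangle\geq 1-\delta\right\}.$$
   Formalization: In the second case it is additionally assumed that μ²θ² − (1−δ)² ≥ 0, since otherwise (e.g. μ = θ = 0, δ = 3/2) the formula contains the square root of a negative number and is undefined. *)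

(* Defs.v *)
From HB Require Import structures.
From mathcomp Require Import all_boot all_order all_algebra.
From mathcomp Require Import sesquilinear.
From mathcomp Require Import all_classical all_reals all_analysis.

Set Implicit Arguments.
Unset Strict Implicit.
Unset Printing Implicit Defensive.

Import Order.TTheory GRing.Theory Num.Theory.
Import numFieldNormedType.Exports.

Local Open Scope classical_set_scope.
Local Open Scope ring_scope.

(* A real Hilbert space is a complete normed module [H] over [R : realType]
   with a positive definite symmetric bilinear form, [{dot H for idfun}],
   that induces the norm of [H]. *)
Definition induces_norm (R : realType) (H : completeNormedModType R)
    (ip : {dot H for idfun}) : Prop :=
  forall x : H, `|x| ^+ 2 = ip x x.

(* [H] need not be finite-dimensional, so [\dim] is not available. *)
Definition dim_ge (R : realType) (H : lmodType R) (n : nat) : Prop :=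
  exists v : 'I_n -> H, forall a : 'I_n -> R,
    \sum_(i < n) a i *: v i = 0 -> forall i, a i = 0.

(* The second component is a vector of [H] standing for a functional, through
   the identification of the dual of [H] with [H]. *)
Definition PiH (R : realType) (H : normedModType R) : set (H * H) :=
  [set (z, z) | z in [set z : H | `|z| = 1]].

Definition dist_infty (R : realType) (H : normedModType R)
    (p : H * H) (A : set (H * H)) : R :=
  inf [set Num.max `|p.1 - q.1| `|p.2 - q.2| | q in A].

Definition Phi (R : realType) (H : completeNormedModType R)
    (ip : {dot H for idfun}) (mu theta delta : R) : R :=
  sup [set dist_infty p (@PiH R H) | p in [set p : H * H |
    [/\ `|p.1| = mu, `|p.2| = theta & 1 - delta <= ip p.1 p.2]]].

Definition radicand (R : realType) (mu theta delta : R) : R :=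
  mu ^+ 2 * theta ^+ 2 - (1 - delta) ^+ 2.

Definition lambda (R : realType) (mu theta delta : R) : R :=
  (- 2 * Num.sqrt (radicand mu theta delta)
   + Num.sqrt (4 * (mu ^+ 2 + theta ^+ 2 - 2 + 2 * delta)
               - (mu ^+ 2 - theta ^+ 2) ^+ 2))
  / (2 * (mu ^+ 2 + theta ^+ 2 - 2 + 2 * delta)).

(* Main.v *)
Require Import Defs.
From HB Require Import structures.
From mathcomp Require Import all_boot all_order all_algebra.
From mathcomp Require Import sesquilinear.
From mathcomp Require Import all_classical all_reals all_analysis.
From mathcomp Require Import ring lra.

Set Implicit Arguments.
Unset Strict Implicit.
Unset Printing Implicit Defensive.

Import Order.TTheory GRing.Theory Num.Theory.
Import numFieldNormedType.Exports.

Local Open Scope classical_set_scope.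
Local Open Scope ring_scope.

(** Fix [x], [y] of norms [mu >= theta] and write [c] for their inner product.
    The quantity to minimise over unit [z] is the larger of the distances from
    [z] to [x] and to [y].  It is at least [1 - theta], the distance from [y] to
    the sphere.  The bound is reached at [z = y / theta] exactly when [x] is not
    farther from [y / theta] than [y] is, which is
    [theta^2 + theta * (mu^2 - theta^2) / 2 <= c] ([radial_approx]).

    For smaller [c] the minimiser is the unit vector [z] equidistant from [x] and
    [y] on the arc between their directions.  By convex duality its
    optimality is certified by weights [s], [1 - s] in [[0, 1]] such that
    [s x + (1 - s) y] is a nonnegative multiple of [z]; [saddle_point] records
    these data and [saddle_point_exists] constructs them.  The explicit [z] gives
    the square root in the statement.

    The supremum over [c >= 1 - delta] still requires the minimal distance to
    decrease with [c].  No derivative is needed: the certificate involves [x] and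
    [y] only through the norm of [s x + (1 - s) y], which increases with [c].
    Hence a saddle point for [(x, y)] bounds from below the distances not only for
    [(x, y)] but for every pair with the same norms and an inner product no larger
    ([saddle_point_le]).  Used for a pair [(x0, y0)] with inner product exactly
    [1 - delta], this gives the value at [(x0, y0)]; used for any other admissible
    pair, against the optimal [z0] of [(x0, y0)], it shows that this value is
    the supremum. *)

(** * Inner product and norm *)
Section Hilbert.
Variables (R : realType) (H : completeNormedModType R) (ip : {dot H for idfun}).
Hypothesis ip_norm : induces_norm ip.

Lemma ipC x y : ip x y = ip y x.
Proof. by rewrite hermC /= expr0 mul1r. Qed.

Lemma ipZl (a : R) x z : ip (a *: x) z = a * ip x z.
Proof. exact: linearZl_LR. Qed.

Lemma ipZr (a : R) x z : ip z (a *: x) = a * ip z x.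
Proof. exact: linearZr_LR. Qed.

Lemma ip_lincomb_l (a b : R) x y z :
  ip (a *: x + b *: y) z = a * ip x z + b * ip y z.
Proof. by rewrite linearDl !linearZl_LR. Qed.

Lemma ip_lincomb_r (a b : R) x y z :
  ip z (a *: x + b *: y) = a * ip z x + b * ip z y.
Proof. by rewrite linearDr !linearZr_LR. Qed.

Lemma sqr_norm_lincomb (a b : R) x y :
  `|a *: x + b *: y| ^+ 2
  = a ^+ 2 * `|x| ^+ 2 + b ^+ 2 * `|y| ^+ 2 + 2 * (a * b) * ip x y.
Proof.
by rewrite !ip_norm ip_lincomb_l !ip_lincomb_r (ipC y x); ring.
Qed.

Lemma sqr_normB x y : `|x - y| ^+ 2 = `|x| ^+ 2 + `|y| ^+ 2 - 2 * ip x y.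
Proof.
have -> : x - y = 1 *: x + (-1) *: y by rewrite scale1r scaleN1r.
by rewrite sqr_norm_lincomb; ring.
Qed.

Lemma ipBl x y z : ip (x - y) z = ip x z - ip y z.
Proof. exact: linearBl. Qed.

(** Expanding the square of the triangle inequality. *)
Lemma ip_le_norm x y : ip x y <= `|x| * `|y|.
Proof.
have le_sq : `|x + y| ^+ 2 <= (`|x| + `|y|) ^+ 2.
  by rewrite lerXn2r ?nnegrE ?addr_ge0 ?normr_ge0 // ler_normD.
move: le_sq; rewrite -[X in `|X + _|]scale1r -[X in `|_ + X|]scale1r.
rewrite sqr_norm_lincomb; lra.
Qed.

Lemma norm1_normalize (w : H) : w != 0 -> `| `|w|^-1 *: w| = 1.
Proof.
move=> w_neq0.
by rewrite normrZ normfV normr_id mulVf // normr_eq0.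
Qed.

(** Of two independent vectors, the combination orthogonal to [u] obtained by
    exchanging their inner products with [u] vanishes only if both of them are
    already orthogonal to [u].  This treats [u = 0] along with the rest. *)
Lemma unit_orthogonal :
  dim_ge H 2 -> forall u, exists2 w : H, `|w| = 1 & ip u w = 0.
Proof.
move=> [v free_v] u.
suff [w w_neq0 uw0] : exists2 w : H, w != 0 & ip u w = 0.
  exists (`|w|^-1 *: w); first exact: norm1_normalize.
  by rewrite ipZr uw0 mulr0.
pose v0 := v ord0; pose v1 := v ord_max.
have free2 (a b : R) : a *: v0 + b *: v1 = 0 -> a = 0 /\ b = 0.
  move=> ab0; have := free_v (fun i => if i == ord0 then a else b).
  rewrite big_ord_recl big_ord1 /=.
  have -> : lift ord0 ord0 = ord_max :> 'I_2 by apply: val_inj.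
  by move=> /(_ ab0) coef0; split; [exact: (coef0 ord0)|exact: (coef0 ord_max)].
have [w0|w_neq0] := eqVneq (ip u v1 *: v0 + (- ip u v0) *: v1) 0; last first.
  exists (ip u v1 *: v0 + (- ip u v0) *: v1) => //.
  by rewrite ip_lincomb_r; ring.
have [_ /eqP] := free2 _ _ w0; rewrite oppr_eq0 => /eqP uv0.
exists v0 => //; apply/eqP => v0_eq0.
have [] := free2 1 0; first by rewrite v0_eq0 scaler0 scale0r addr0.
by move/eqP; rewrite oner_eq0.
Qed.

(** Both the infimum and the supremum in [Phi] are attained in all the cases
    considered, so [Phi] is computed by exhibiting an extremal pair [(x0, y0)]
    and a good [z] for every admissible pair. *)
Lemma Phi_eq (mu theta delta d : R) (x0 y0 : H) :
  `|x0| = mu -> `|y0| = theta -> 1 - delta <= ip x0 y0 ->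
  (forall z, `|z| = 1 -> d <= Num.max `|x0 - z| `|y0 - z|) ->
  (forall x y, `|x| = mu -> `|y| = theta -> 1 - delta <= ip x y ->
     exists2 z : H, `|z| = 1 & Num.max `|x - z| `|y - z| <= d) ->
  Phi ip mu theta delta = d.
Proof.
move=> x0_mu y0_theta adm0 lower upper.
have dist_le (x y : H) : `|x| = mu -> `|y| = theta -> 1 - delta <= ip x y ->
    dist_infty (x, y) (@PiH R H) <= d.
  move=> x_mu y_theta adm; have [z z1 zd] := upper x y x_mu y_theta adm.
  apply: le_trans zd; apply: ge_inf.
    by exists 0 => _ [q _ <-]; rewrite le_max normr_ge0.
  by exists (z, z) => //; exists z.
have dist0 : d <= dist_infty (x0, y0) (@PiH R H).
  have [z z1 _] := upper x0 y0 x0_mu y0_theta adm0.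
  apply: lb_le_inf.
    by exists (Num.max `|x0 - z| `|y0 - z|), (z, z) => //; exists z.
  by move=> _ [_ [q q1 <-] <-]; exact: lower.
apply/eqP; rewrite eq_le; apply/andP; split.
  apply: ge_sup; first by exists (dist_infty (x0, y0) (@PiH R H)), (x0, y0).
  by move=> _ [[x y] [x_mu y_theta adm] <-]; exact: dist_le.
apply: (le_trans dist0); apply: ub_le_sup.
  by exists d => _ [[x y] [x_mu y_theta adm] <-]; exact: dist_le.
by exists (x0, y0).
Qed.

(** * Saddle points *)

(** [z] minimises the larger of the two distances, and the weights [s], [1 - s]
    are the dual solution: the weighted sum of the two squared distances is also
    minimal at [z], since [z] points in the direction of [s x + (1 - s) y].  The
    factor [r] must be allowed to vanish, for [x] and [y] opposite in
    direction. *)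
Definition saddle_point (x y z : H) : Prop :=
  [/\ `|z| = 1, `|x - z| = `|y - z| &
      exists s r : R, [/\ 0 <= s <= 1, 0 <= r & s *: x + (1 - s) *: y = r *: z]].

(** The larger of two numbers is at least their weighted mean, and the weighted
    mean of the squared distances from [z'] to [x'] and [y'] is smallest when
    the inner product of [z'] with [s x' + (1 - s) y'] is largest, that is, equal
    to the norm of that vector.  This norm is at most [r], the norm of
    [s x + (1 - s) y], because it grows with the inner product. *)
Lemma saddle_point_le (x y z x' y' z' : H) :
  saddle_point x y z -> `|x'| = `|x| -> `|y'| = `|y| -> `|z'| = 1 ->
  ip x' y' <= ip x y ->
  `|x - z| <= Num.max `|x' - z'| `|y' - z'|.
Proof.
move=> [z1 equidist [s [r [/andP[s_ge0 s_le1] r_ge0 comb]]]] x'x y'y z'1 le_ip.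
set M := Num.max _ _.
have M_ge0 : 0 <= M by rewrite le_max normr_ge0.
have sx : `|x' - z'| ^+ 2 <= M ^+ 2.
  by rewrite lerXn2r ?nnegrE ?normr_ge0 // le_max lexx.
have sy : `|y' - z'| ^+ 2 <= M ^+ 2.
  by rewrite lerXn2r ?nnegrE ?normr_ge0 // le_max lexx orbT.
have norm_comb : `|s *: x' + (1 - s) *: y'| <= r.
  rewrite -(@ler_pXn2r _ 2) ?nnegrE ?normr_ge0 //.
  have <- : `|r *: z| ^+ 2 = r ^+ 2 by rewrite normrZ z1 mulr1 ger0_norm.
  rewrite -comb !sqr_norm_lincomb x'x y'y lerD2l.
  by rewrite ler_wpM2l // !mulr_ge0 // subr_ge0.
have ip' : s * ip x' z' + (1 - s) * ip y' z' <= r.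
  rewrite -ip_lincomb_l; apply: le_trans (ip_le_norm _ _) _.
  by rewrite z'1 mulr1.
have ipE : s * ip x z + (1 - s) * ip y z = r.
  by rewrite -ip_lincomb_l comb ipZl -ip_norm z1 expr1n mulr1.
rewrite -(@ler_pXn2r _ 2) ?nnegrE ?normr_ge0 //.
have eq2 : `|x - z| ^+ 2 = `|y - z| ^+ 2 by rewrite equidist.
have split2 : `|x - z| ^+ 2 = s * `|x - z| ^+ 2 + (1 - s) * `|y - z| ^+ 2.
  by rewrite -eq2; ring.
have : s * `|x' - z'| ^+ 2 + (1 - s) * `|y' - z'| ^+ 2 <= M ^+ 2.
  have -> : M ^+ 2 = s * M ^+ 2 + (1 - s) * M ^+ 2 by ring.
  by rewrite lerD // ler_wpM2l // subr_ge0.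
rewrite split2; apply: le_trans.
rewrite !sqr_normB x'x y'y z1 z'1; lra.
Qed.

End Hilbert.

(** * The weights of the equidistant point *)

Section Weights.
Variables (R : realType) (mu theta c : R).
Hypotheses (theta_gt0 : 0 < theta) (theta_le_mu : theta <= mu).
Hypothesis mu_le1 : mu <= 1.
Hypothesis c_lt : c < theta ^+ 2 + theta * ((mu ^+ 2 - theta ^+ 2) / 2).

Local Notation m := ((mu ^+ 2 - theta ^+ 2) / 2).

Lemma half_diff_sqr_ge0 : 0 <= m.
Proof. by have := theta_gt0; have := theta_le_mu; nra. Qed.

(** Below the threshold [x] and [y] are not positively proportional. *)
Lemma ip_lt_mul : c < mu * theta.
Proof.
apply: (lt_le_trans c_lt).
have -> : mu * theta = theta ^+ 2 + theta * (mu - theta) by ring.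
rewrite lerD2l ler_wpM2l ?(ltW theta_gt0) //.
have -> : m = (mu - theta) * ((mu + theta) / 2) by ring.
rewrite ler_piMr ?subr_ge0 //; have := theta_le_mu; have := mu_le1; lra.
Qed.

Lemma sqr_dist_gt0 : 0 < mu ^+ 2 + theta ^+ 2 - 2 * c.
Proof. by have := ip_lt_mul; have := sqr_ge0 (mu - theta); lra. Qed.

(** With [Q] the squared norm of [x - y], a unit vector equidistant from [x] and
    [y] has component [m / sqrt Q] along [x - y], hence squared length
    [1 - m^2 / Q] across it.  Positivity says that the perpendicular bisector
    crosses the unit sphere transversally. *)
Lemma bisector_gt0 : 0 < mu ^+ 2 + theta ^+ 2 - 2 * c - m ^+ 2.
Proof.
have := ip_lt_mul.
suff : m ^+ 2 <= (mu - theta) ^+ 2 by lra.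
rewrite lerXn2r ?nnegrE ?half_diff_sqr_ge0 ?subr_ge0 //.
have -> : m = (mu - theta) * ((mu + theta) / 2) by ring.
rewrite ler_piMr ?subr_ge0 //; have := theta_le_mu; have := mu_le1; lra.
Qed.

(** In the plane of [x] and [y], [S] is the area of the parallelogram that they
    span, and [T / sqrt Q] is the component of the equidistant unit vector
    across [x - y]. *)
Variables S T : R.
Hypotheses (S_ge0 : 0 <= S) (T_gt0 : 0 < T).
Hypothesis SE : S ^+ 2 = mu ^+ 2 * theta ^+ 2 - c ^+ 2.
Hypothesis TE : T ^+ 2 = mu ^+ 2 + theta ^+ 2 - 2 * c - m ^+ 2.

(** The weight of [x] changes sign exactly at the threshold for [c]: where the
    first term is negative, the difference of the squares of the two terms
    factors, and the last factor is the defect from the threshold. *)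
Lemma weight_x_ge0 : 0 <= T * (theta ^+ 2 - c) + S * m.
Proof.
have m_ge0 := half_diff_sqr_ge0.
have [c_le|c_gt] := lerP c (theta ^+ 2).
  by rewrite addr_ge0 // mulr_ge0 // ?subr_ge0 // ltW.
rewrite -[X in X + _]opprK -mulrN opprB addrC subr_ge0.
have Tu_ge0 : 0 <= T * (c - theta ^+ 2).
  by rewrite mulr_ge0 // ?subr_ge0 ltW.
have Sm_ge0 : 0 <= S * m by exact: mulr_ge0.
rewrite -(@ler_pXn2r _ 2) //.
rewrite [(S * _) ^+ 2]exprMn [(T * _) ^+ 2]exprMn SE TE -subr_ge0.
have -> : (mu ^+ 2 * theta ^+ 2 - c ^+ 2) * m ^+ 2
          - (mu ^+ 2 + theta ^+ 2 - 2 * c - m ^+ 2) * (c - theta ^+ 2) ^+ 2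
    = 2 * (theta ^+ 2 + m - c) * ((theta * m) ^+ 2 - (c - theta ^+ 2) ^+ 2).
  by field.
have Q_gt0 := sqr_dist_gt0.
apply: mulr_ge0; first by rewrite mulr_ge0 //; lra.
have u_le : c - theta ^+ 2 <= theta * m by have := c_lt; lra.
have u_ge0 : 0 <= c - theta ^+ 2 by rewrite subr_ge0 ltW.
by rewrite subr_ge0; apply: lerXn2r; rewrite ?nnegrE // (le_trans u_ge0).
Qed.

(** The threshold for the weight of [y] is the mirror image of the one for [x],
    and [theta <= mu <= 1] puts [c] on the good side of it. *)
Lemma weight_y_ge0 : 0 <= T * (mu ^+ 2 - c) - S * m.
Proof.
have m_ge0 := half_diff_sqr_ge0; have Q_gt0 := sqr_dist_gt0.
have m_le : m <= mu ^+ 2 - c by lra.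
have mmu_le : mu * m <= mu ^+ 2 - c.
  by apply: le_trans m_le; rewrite ler_piMl.
rewrite subr_ge0.
have Tv_ge0 : 0 <= T * (mu ^+ 2 - c).
  by apply: mulr_ge0; [exact: ltW | exact: le_trans m_le].
have Sm_ge0 : 0 <= S * m by exact: mulr_ge0.
rewrite -(@ler_pXn2r _ 2) //.
rewrite [(S * _) ^+ 2]exprMn [(T * _) ^+ 2]exprMn SE TE -subr_ge0.
have -> : (mu ^+ 2 + theta ^+ 2 - 2 * c - m ^+ 2) * (mu ^+ 2 - c) ^+ 2
          - (mu ^+ 2 * theta ^+ 2 - c ^+ 2) * m ^+ 2
    = 2 * (mu ^+ 2 - c - m) * ((mu ^+ 2 - c) ^+ 2 - (mu * m) ^+ 2) by field.
apply: mulr_ge0; first by rewrite mulr_ge0 // subr_ge0.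
rewrite subr_ge0; apply: lerXn2r; rewrite ?nnegrE ?(le_trans m_ge0 m_le) //.
by rewrite mulr_ge0 // (le_trans (ltW theta_gt0)).
Qed.

(** Up to normalisation [A] and [B] are the weights, so this computes the norm of
    the weighted sum of [x] and [y]. *)
Lemma gram_weights (A := T * (theta ^+ 2 - c) + S * m)
    (B := T * (mu ^+ 2 - c) - S * m) (Q := mu ^+ 2 + theta ^+ 2 - 2 * c) :
  A ^+ 2 * mu ^+ 2 + B ^+ 2 * theta ^+ 2 + 2 * (A * B) * c = (S * Q) ^+ 2.
Proof.
transitivity (Q * (T ^+ 2 * (mu ^+ 2 * theta ^+ 2 - c ^+ 2) + S ^+ 2 * m ^+ 2)).
  by rewrite /A /B /Q; field.
by rewrite -SE TE /Q; ring.
Qed.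

End Weights.

(** * Optimal approximation of a pair *)

Section Saddle.
Variables (R : realType) (H : completeNormedModType R) (ip : {dot H for idfun}).
Hypotheses (ip_norm : induces_norm ip) (dimH : dim_ge H 2).
Variables (mu theta : R).
Hypotheses (theta_gt0 : 0 < theta) (theta_le_mu : theta <= mu).
Hypothesis mu_le1 : mu <= 1.

Local Notation m := ((mu ^+ 2 - theta ^+ 2) / 2).

(** The weights are the coordinates, rescaled to have sum one, of the equidistant
    unit vector in the basis [x], [y].  Their formula makes sense even when [x]
    and [y] are linearly dependent, so [s] comes first and [z] second. *)
Lemma saddle_point_exists (x y : H) : `|x| = mu -> `|y| = theta ->
  ip x y < theta ^+ 2 + theta * m ->
  exists2 z, saddle_point x y z &
    `|x - z| = Num.sqrt (1 - ip x y - 2 * lambda mu theta (1 - ip x y)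
                 * Num.sqrt (radicand mu theta (1 - ip x y))).
Proof.
move=> x_mu y_theta c_lt; set c := ip x y in c_lt *.
pose S := Num.sqrt (mu ^+ 2 * theta ^+ 2 - c ^+ 2).
pose T := Num.sqrt (mu ^+ 2 + theta ^+ 2 - 2 * c - m ^+ 2).
set Q := mu ^+ 2 + theta ^+ 2 - 2 * c in T.
have Q_gt0 : 0 < Q by exact: sqr_dist_gt0.
have T_gt0 : 0 < T by rewrite sqrtr_gt0; exact: bisector_gt0.
have S_ge0 : 0 <= S by exact: sqrtr_ge0.
have mu_ge0 : 0 <= mu by exact: le_trans (ltW theta_gt0) theta_le_mu.
have c_le : c <= mu * theta by rewrite -x_mu -y_theta ip_le_norm.
have c_ge : - (mu * theta) <= c.
  rewrite lerNl -x_mu -y_theta -(normrN x).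
  by apply: le_trans (ip_le_norm ip_norm _ _); rewrite linearNl.
have SE : S ^+ 2 = mu ^+ 2 * theta ^+ 2 - c ^+ 2.
  rewrite sqr_sqrtr //.
  have -> : mu ^+ 2 * theta ^+ 2 - c ^+ 2
            = (mu * theta - c) * (mu * theta + c) by ring.
  by rewrite mulr_ge0; lra.
have TE : T ^+ 2 = Q - m ^+ 2 by rewrite sqr_sqrtr // ltW //; exact: bisector_gt0.
pose s := (T * (theta ^+ 2 - c) + S * m) / (T * Q).
have Q_neq0 : Q != 0 by rewrite gt_eqF.
have T_neq0 : T != 0 by rewrite gt_eqF.
have onemsE : 1 - s = (T * (mu ^+ 2 - c) - S * m) / (T * Q).
  rewrite /s; apply: (mulIf (mulf_neq0 T_neq0 Q_neq0)).
  by rewrite mulrBl !divfK ?mulf_neq0 // /Q; field.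
have s01 : 0 <= s <= 1.
  apply/andP; split.
    apply: divr_ge0; last by rewrite mulr_ge0 // ltW.
    exact: (@weight_x_ge0 _ mu theta c _ _ _ _ S T).
  rewrite -subr_ge0 onemsE; apply: divr_ge0; last by rewrite mulr_ge0 // ltW.
  exact: (@weight_y_ge0 _ mu theta c _ _ _ _ S T).
pose r := S / T.
have r_ge0 : 0 <= r by rewrite divr_ge0 // ltW.
pose u := s *: x + (1 - s) *: y.
have norm_u : `|u| ^+ 2 = r ^+ 2.
  rewrite /u (sqr_norm_lincomb ip_norm) x_mu y_theta -/c onemsE /s /r.
  have -> : (S / T) ^+ 2 = (S * Q) ^+ 2 / (T * Q) ^+ 2 by field; rewrite Q_neq0.
  by rewrite -(gram_weights _ TE) //; field; rewrite Q_neq0.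
have norm_ur : `|u| = r.
  by apply/eqP; rewrite -(@eqrXn2 _ 2) ?normr_ge0 // norm_u.
have ip_u : ip (x - y) u = r * m.
  rewrite ip_lincomb_r !ipBl -!ip_norm x_mu y_theta (ipC ip y x) -/c.
  rewrite onemsE /s /r.
  by rewrite /Q; field; rewrite T_neq0.
have norm_xy : `|x - y| ^+ 2 = Q by rewrite (sqr_normB ip_norm) x_mu y_theta.
have [z [z1 zu zm]] : exists z, [/\ `|z| = 1, u = r *: z & ip (x - y) z = m].
  (* If [r = 0], the weighted sum vanishes and gives no direction: [z] is then
     built from its component along [x - y] and any orthogonal direction. *)
  have [r0|r_neq0] := eqVneq r 0; last first.
    exists (r^-1 *: u); split.
    - by rewrite normrZ norm_ur ger0_norm ?invr_ge0 // mulVf.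
    - by rewrite scalerA mulfV // scale1r.
    - by rewrite ipZr ip_u mulKf.
  have [w w1 xyw0] := unit_orthogonal ip dimH (x - y).
  exists ((m / Q) *: (x - y) + (T / Num.sqrt Q) *: w); split.
  - apply/eqP; rewrite -(@eqrXn2 _ 2) ?normr_ge0 // (sqr_norm_lincomb ip_norm).
    rewrite norm_xy w1 xyw0 mulr0 [(T / _) ^+ 2]expr_div_n TE.
    rewrite sqr_sqrtr ?(ltW Q_gt0) //.
    by apply/eqP; field; exact: Q_neq0.
  - by rewrite r0 scale0r; apply/eqP; rewrite -normr_eq0 norm_ur r0.
  - by rewrite ip_lincomb_r xyw0 -ip_norm norm_xy mulr0 addr0 divfK.
have ip_xz : ip x z = r + (1 - s) * m.
  have : ip u z = r by rewrite zu ipZl -ip_norm z1 expr1n mulr1.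
  rewrite ip_lincomb_l -zm ipBl; lra.
have dist2 : `|x - z| ^+ 2 = `|y - z| ^+ 2.
  rewrite 2!(sqr_normB ip_norm) x_mu y_theta z1; move: zm; rewrite ipBl; lra.
exists z.
  split => //; last by exists s, r.
  by apply/eqP; rewrite -(@eqrXn2 _ 2) ?normr_ge0 // dist2.
rewrite -[LHS]ger0_norm // -sqrtr_sqr; congr Num.sqrt.
rewrite (sqr_normB ip_norm) x_mu z1 ip_xz onemsE /r.
have radE : radicand mu theta (1 - c) = mu ^+ 2 * theta ^+ 2 - c ^+ 2.
  by rewrite /radicand; ring.
have -> : lambda mu theta (1 - c) = (T - S) / Q.
  rewrite /lambda radE.
  have -> : mu ^+ 2 + theta ^+ 2 - 2 + 2 * (1 - c) = Q by rewrite /Q; ring.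
  have -> : 4 * Q - (mu ^+ 2 - theta ^+ 2) ^+ 2 = 2 ^+ 2 * (Q - m ^+ 2) by field.
  rewrite sqrtrM ?sqr_ge0 // sqrtr_sqr ger0_norm // -/S -/T.
  by field.
rewrite radE -/S.
(* In the middle expression [S^2] is expanded and [Q] is kept as [T^2 + m^2], so
   that each of the two equalities eliminates only one square root. *)
transitivity (1 - c + 2 * (mu ^+ 2 * theta ^+ 2 - c ^+ 2) / Q
  - 2 * (S * (T ^+ 2 + m ^+ 2) / (T * Q)) + 2 * (S * m ^+ 2 / (T * Q))).
  by rewrite TE /Q; field; rewrite Q_neq0.
by rewrite -SE; field; rewrite Q_neq0.
Qed.

(** The nearest unit vector to [y] is good enough as soon as [x] is not farther
    from it than [y] is, and squaring turns this into the threshold for [c]. *)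
Lemma radial_approx (x y : H) : `|x| = mu -> `|y| = theta ->
  theta ^+ 2 + theta * m <= ip x y ->
  exists2 z : H, `|z| = 1 & Num.max `|x - z| `|y - z| <= 1 - theta.
Proof.
move=> x_mu y_theta c_ge.
have theta_le1 : theta <= 1 by exact: le_trans mu_le1.
have theta_neq0 : theta != 0 by rewrite gt_eqF.
exists (theta^-1 *: y).
  by rewrite normrZ y_theta ger0_norm ?invr_ge0 ?(ltW theta_gt0) // mulVf.
rewrite ge_max; apply/andP; split.
  rewrite -(@ler_pXn2r _ 2) ?nnegrE ?subr_ge0 //.
  rewrite (sqr_normB ip_norm) normrZ ipZr x_mu y_theta.
  rewrite ger0_norm ?invr_ge0 ?(ltW theta_gt0) // mulVf //.
  have -> : (1 - theta) ^+ 2 =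
      mu ^+ 2 + 1 ^+ 2 - 2 * (theta^-1 * (theta ^+ 2 + theta * m)) by field.
  by rewrite lerD2l lerN2 ler_wpM2l // ler_wpM2l // invr_ge0 ltW.
have -> : y - theta^-1 *: y = (1 - theta^-1) *: y by rewrite scalerBl scale1r.
rewrite normrZ y_theta -[X in _ * X](ger0_norm (ltW theta_gt0)) -normrM.
by rewrite mulrBl mul1r mulVf // distrC ger0_norm // subr_ge0.
Qed.

End Saddle.

(** * The modulus *)

(* For 1 - delta < - (mu * theta) the formula of the second case contains the
   square root of a negative number; that case is therefore stated under the
   hypothesis that this radicand is nonnegative.  The other radicands and the
   denominator of lambda need no such hypothesis. *)
Theorem corollary2p16 (R : realType) (H : completeNormedModType R)
    (ip : {dot H for idfun}) (ip_norm : induces_norm ip)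
    (dimH : dim_ge H 2) (delta mu theta : R)
    (delta_gt0 : 0 < delta) (delta_lt2 : delta < 2)
    (mu_ge0 : 0 <= mu) (mu_le1 : mu <= 1)
    (theta_ge0 : 0 <= theta) (theta_le1 : theta <= 1)
    (theta_le_mu : theta <= mu) (mu_theta : 1 - delta < mu * theta) :
  (theta ^+ 2 + theta * ((mu ^+ 2 - theta ^+ 2) / 2) <= 1 - delta ->
     Phi ip mu theta delta = 1 - theta)
  /\
  (1 - delta < theta ^+ 2 + theta * ((mu ^+ 2 - theta ^+ 2) / 2) ->
     0 <= radicand mu theta delta ->
     Phi ip mu theta delta =
     Num.max (1 - theta)
       (Num.sqrt (delta - 2 * lambda mu theta delta
                          * Num.sqrt (radicand mu theta delta)))).
Proof.
have [e e1 _] := unit_orthogonal ip dimH 0.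
have lower_theta (y z : H) : `|y| = theta -> `|z| = 1 -> 1 - theta <= `|y - z|.
  by move=> <- <-; rewrite distrC lerB_dist.
(* For [theta = 0] both cases are void: [1 - delta] is negative by [mu_theta]. *)
have [theta_eq0|theta_neq0] := eqVneq theta 0.
  have k_lt0 : 1 - delta < 0 by move: mu_theta; rewrite theta_eq0 mulr0.
  rewrite /radicand theta_eq0 expr0n /= mulr0 mul0r add0r sub0r oppr_ge0.
  split=> [k_ge0|_ sqr_le0].
    by move: (lt_le_trans k_lt0 k_ge0); rewrite ltxx.
  have : 0 < (1 - delta) ^+ 2 by rewrite exprn_even_gt0 //= lt_eqF.
  by rewrite ltNge sqr_le0.
have theta_gt0 : 0 < theta by rewrite lt_def theta_neq0.
have mu_gt0 : 0 < mu by exact: lt_le_trans theta_le_mu.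
split=> [k_ge|k_lt rad_ge0].
  apply: (@Phi_eq _ _ _ _ _ _ _ (mu *: e) (theta *: e)).
  - by rewrite normrZ e1 mulr1 ger0_norm.
  - by rewrite normrZ e1 mulr1 ger0_norm.
  - by rewrite ipZl ipZr -ip_norm e1 expr1n mulr1 ltW.
  - move=> z z1; rewrite le_max; apply/orP; right; apply: lower_theta => //.
    by rewrite normrZ e1 mulr1 ger0_norm.
  - move=> x y x_mu y_theta adm; exact: radial_approx (le_trans k_ge adm).
have [f f1 ef0] := unit_orthogonal ip dimH e.
(* A pair with inner product exactly [1 - delta], the extremal one. *)
pose k := 1 - delta; pose S := Num.sqrt (radicand mu theta delta).
pose x0 := mu *: e; pose y0 := (k / mu) *: e + (S / mu) *: f.
have mu_neq0 : mu != 0 by rewrite gt_eqF.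
have x0_mu : `|x0| = mu by rewrite normrZ e1 mulr1 ger0_norm.
have y0_theta : `|y0| = theta.
  apply/eqP; rewrite -(@eqrXn2 _ 2) //.
  rewrite (sqr_norm_lincomb ip_norm) e1 f1 ef0 [(S / _) ^+ 2]expr_div_n.
  rewrite sqr_sqrtr // /radicand -/k mulr0.
  by apply/eqP; field.
have x0y0 : ip x0 y0 = k.
  rewrite ip_lincomb_r !ipZl ef0 -ip_norm e1.
  by field.
have saddle := saddle_point_exists ip_norm dimH theta_gt0 theta_le_mu mu_le1.
have [|z0 saddle0] := saddle _ _ x0_mu y0_theta.
  by rewrite x0y0.
have -> : 1 - ip x0 y0 = delta by rewrite x0y0 /k; ring.
move=> dist0; rewrite -dist0.
have [z01 equidist0 _] := saddle0.
have dist0_ge : 1 - theta <= `|x0 - z0| by rewrite equidist0 lower_theta.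
rewrite max_r //.
apply: (@Phi_eq _ _ _ _ _ _ _ x0 y0) => // [|z z1|x y x_mu y_theta adm].
- by rewrite x0y0.
- exact: saddle_point_le saddle0 _ _ _ _.
- have [c_lt|c_ge] := ltP (ip x y)
    (theta ^+ 2 + theta * ((mu ^+ 2 - theta ^+ 2) / 2)).
    have [z saddle_z _] := saddle _ _ x_mu y_theta c_lt.
    have [z1 equidist _] := saddle_z.
    exists z => //; rewrite -equidist maxxx.
    (* The roles are exchanged here: [z] certifies, [(x0, y0)] has the smaller
       inner product, and [z0] is the competitor. *)
    have := saddle_point_le ip_norm saddle_z _ _ z01 _.
    move=> /(_ x0 y0); rewrite x0_mu y0_theta x_mu y_theta x0y0 -equidist0 maxxx.
    exact.
  have [z z1 zd] :=
    radial_approx ip_norm theta_gt0 theta_le_mu mu_le1 x_mu y_theta c_ge.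
  by exists z => //; exact: le_trans dist0_ge.
Qed.
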